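(* Let $X$ and $Y$ be real locally convex topological vector spaces and let $F\colon X\rightrightarrows Y$ be a set-valued mapping. Then $$\operatorname{iri}(\operatorname{gph}(F))\subset\{(x,y)\in X\times Y\mid x\in\operatorname{iri}(\operatorname{dom}(F)),\ y\in\operatorname{iri}(F(x))\}.$$ Assuming in addition that $F$ is convex, we have the equality $$\operatorname{iri}(\operatorname{gph}(F))=\{(x,y)\in X\times Y\mid x\in\operatorname{iri}(\operatorname{dom}(F)),\ y\in\operatorname{iri}(F(x))\}.$$
   Context: A set-valued mapping $F\colon X\rightrightarrows Y$ assigns to each $x\in X$ a (possibly empty) subset $F(x)\subset Y$; $\operatorname{dom}(F)=\{x\in X\mid F(x)\neq\emptyset\}$ and $\operatorname{gph}(F)=\{(x,y)\in X\times Y\mid y\in F(x)\}$. $F$ is called convex if $\operatorname{gph}(F)$ is a convex subset of $X\times Y$. For a subset $\Omega$ of a vector space, $\operatorname{cone}(\Omega)=\{\lambda w\mid \lambda\ge 0,\ w\in\Omega\}$ (no convexification). The intrinsic relative interior of a (not necessarily convex) set $\Omega$ is $\operatorname{iri}(\Omega)=\{x\in\Omega\mid \operatorname{cone}(\Omega-x)\text{ is a linear subspace}\}$. *)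

(* Defs.v *)
From mathcomp Require Import all_boot all_order all_algebra.
From mathcomp Require Import all_classical all_reals all_analysis.

Set Implicit Arguments.
Unset Strict Implicit.
Unset Printing Implicit Defensive.

Import Order.TTheory GRing.Theory Num.Theory.

Local Open Scope classical_set_scope.
Local Open Scope ring_scope.

(* A set-valued mapping from X to Y is a function F : X -> set Y. *)

Definition dom (X Y : Type) (F : X -> set Y) : set X :=
  [set x | F x !=set0].

Definition gph (X Y : Type) (F : X -> set Y) : set (X * Y) :=
  [set z | F z.1 z.2].

Definition convex_mapping (R : numDomainType) (X Y : lmodType R)
    (F : X -> set Y) : Prop :=
  convex_set (gph F : set (convex_lmodType (X * Y)%type)).

(* The cone generated by A, with no convexification; it contains 0 as soon as
   A is nonempty, since the factor l may vanish. *)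
Definition cone (R : numDomainType) (V : lmodType R) (A : set V) : set V :=
  [set l *: w | l in [set l : R | 0 <= l] & w in A].

Definition linear_subspace (R : numDomainType) (V : lmodType R) (A : set V)
    : Prop :=
  GRing.submod_closed (mem A).

Definition iri (R : numDomainType) (V : lmodType R) (A : set V) : set V :=
  [set x | A x /\ linear_subspace (cone [set w - x | w in A])].

(* Main.v *)
Require Import Defs.
From mathcomp Require Import all_boot all_order all_algebra.
From mathcomp Require Import all_classical all_reals all_analysis.
From mathcomp Require Import ring.

(** The statement is purely algebraic.  For a point [x] of [A], the cone
generated by [A - x] is the set of feasible directions of [A] at [x]: the
vectors [v] such that [x + t v] lies in [A] for some [t > 0]
([cone_shiftE]).  So [x] is in the intrinsic relative interior of [A] exactly
when the feasible directions at [x] form a linear subspace.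

Fix a point [(x, y)] of the graph and let [K] be its set of feasible directions
in the graph.  For an arbitrary [F], the feasible directions of the domain at
[x] are the projection of [K] on [X] ([feasible_dom]), and those of the fiber
[F x] at [y] are the slice of [K] over [0] ([feasible_fiber]).  Projections and
slices of a linear subspace are linear subspaces, which is the inclusion.

When the graph is convex, [K] is a convex cone, so it is a subspace as soon as
it is symmetric.  Let [(u, v)] be in [K].  Since the directions of the domain
are symmetric, some [(- u, w)] is in [K].  The sum [(0, v + w)] is then in the
slice, which is symmetric, so that [(0, - (v + w))] is in [K]; adding
[(- u, w)] to it gives [(- u, - v)]. *)

Import Order.TTheory GRing.Theory Num.Theory.

Local Open Scope classical_set_scope.
Local Open Scope ring_scope.

Definition feasible {R : realFieldType} {V : lmodType R} (A : set V) (x : V)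
  : set V := [set v | exists2 t : R, 0 < t & A (x + t *: v)].

(** The factor [0] of the cone yields only the vector [0], which is feasible
because [x] itself is in [A]; a positive factor is the inverse of a step. *)
Lemma cone_shiftE {R : realFieldType} {V : lmodType R} {A : set V} {x : V} :
  A x -> cone [set w - x | w in A] = feasible A x.
Proof.
move=> Ax; apply/seteqP; split=> [v [l /= l0 [_ [a Aa <-] <-]]|v [t t0 At]].
  have [->|ln0] := eqVneq l 0.
    by exists 1; rewrite ?ltr01//= !scale0r scaler0 addr0.
  exists l^-1; first by rewrite invr_gt0 lt_neqAle eq_sym ln0.
  by rewrite scalerA mulVf// scale1r addrC subrK.
exists t^-1; first by rewrite /= invr_ge0 ltW.
exists (t *: v); first by exists (x + t *: v) => //; rewrite addrC addKr.
by rewrite scalerA mulVf ?scale1r// gt_eqF.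
Qed.

Lemma iriE {R : realFieldType} {V : lmodType R} (A : set V) (x : V) :
  iri A x <-> A x /\ linear_subspace (feasible A x).
Proof. by rewrite /iri /=; split=> -[Ax]; rewrite (cone_shiftE Ax). Qed.

Lemma feasible0 {R : realFieldType} {V : lmodType R} {A : set V} {x : V} :
  A x -> feasible A x 0.
Proof. by move=> Ax; exists 1; rewrite ?ltr01// scaler0 addr0. Qed.

Lemma feasibleZ {R : realFieldType} {V : lmodType R} {A : set V} {x v : V}
    {c : R} :
  0 < c -> feasible A x v -> feasible A x (c *: v).
Proof.
move=> c0 [t t0 At]; exists (t / c); first exact: divr_gt0.
by rewrite scalerA divfK// gt_eqF.
Qed.

(** With steps [s] for [u] and [t] for [v], the convex combination of
[x + s u] and [x + t v] with weights proportional to [t] and [s] gives both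
directions the same coefficient [s t / (s + t)]. *)
Lemma feasibleD {R : realFieldType} {V : lmodType R} {A : set V} {x u v : V} :
  convex_set (A : set (convex_lmodType V)) ->
  feasible A x u -> feasible A x v -> feasible A x (u + v).
Proof.
move=> cA [s s0 As] [t t0 At].
have st0 : 0 < s + t by exact: addr_gt0.
have stn0 : s + t != 0 by rewrite gt_eqF.
pose k := t / (s + t).
have k0 : 0 <= k by rewrite divr_ge0// ltW.
have k1 : k <= 1 by rewrite ler_pdivrMr// mul1r lerDr ltW.
exists (s * t / (s + t)); first by rewrite divr_gt0// mulr_gt0.
have -> : x + (s * t / (s + t)) *: (u + v) =
    k *: (x + s *: u) + (1 - k) *: (x + t *: v).
  rewrite !scalerDr !scalerA addrACA -scalerDl (addrC k) subrK scale1r.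
  by congr (_ + (_ *: _ + _ *: _)); rewrite /k; field.
have := cA (x + s *: u) (x + t *: v) (Itv01 k0 k1).
by rewrite !inE; exact.
Qed.

Lemma linear_subspaceP {R : numDomainType} {V : lmodType R} (L : set V) :
  linear_subspace L <->
  L 0 /\ forall a u v, L u -> L v -> L (a *: u + v).
Proof.
split=> -[L0 Ll]; split.
- by rewrite inE in L0.
- by move=> a u v /mem_set Lu /mem_set Lv; apply/set_mem; exact: Ll.
- by rewrite inE.
- by move=> a u v /set_mem Lu /set_mem Lv; apply/mem_set; exact: Ll.
Qed.

Lemma linear_subspaceN {R : numDomainType} {V : lmodType R} {L : set V}
    (u : V) :
  linear_subspace L -> L u -> L (- u).
Proof.
move=> /linear_subspaceP[L0 Ll] Lu.
by rewrite -scaleN1r -[X in L X]addr0; exact: Ll.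
Qed.

Lemma linear_subspace_image {R : numDomainType} {V W : lmodType R}
    (f : {linear V -> W}) {L : set V} :
  linear_subspace L -> linear_subspace (f @` L).
Proof.
move=> /linear_subspaceP[L0 Ll]; apply/linear_subspaceP; split.
  by exists 0; rewrite ?linear0.
move=> a _ _ [u Lu <-] [v Lv <-].
by exists (a *: u + v); [exact: Ll|rewrite linearP].
Qed.

Lemma linear_subspace_slice {R : numDomainType} {V W : lmodType R}
    {L : set (V * W)} :
  linear_subspace L -> linear_subspace [set w | L (0, w)].
Proof.
move=> /linear_subspaceP[L0 Ll]; apply/linear_subspaceP; split=> //= a u v Lu Lv.
have := Ll a _ _ Lu Lv.
by congr L; apply/pair_eqP; rewrite /= scaler0 addr0 !eqxx.
Qed.

(** Feasible directions of a convex set already form a convex cone; symmetry is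
what lets negative scalars act. *)
Lemma linear_subspace_feasible {R : realFieldType} {V : lmodType R}
    {A : set V} {x : V} :
  convex_set (A : set (convex_lmodType V)) -> A x ->
  (forall v, feasible A x v -> feasible A x (- v)) ->
  linear_subspace (feasible A x).
Proof.
move=> cA Ax symA; apply/linear_subspaceP; split; first exact: feasible0.
move=> a u v Du Dv; apply: feasibleD => //.
have [a0|a0|->] := ltgtP a 0; last by rewrite scale0r; exact: feasible0.
- rewrite -[a]opprK scaleNr; apply: symA.
  by apply: feasibleZ => //; rewrite oppr_gt0.
- exact: feasibleZ.
Qed.

(** A direction [u] of the domain lifts to the graph: reaching a value [y'] over
[z.1 + t u] with the same step [t] determines the second component. *)
Lemma feasible_dom {R : realFieldType} {X Y : lmodType R} (F : X -> set Y)
    (z : X * Y) :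
  feasible (dom F) z.1 = fst @` feasible (gph F) z.
Proof.
apply/seteqP; split=> [u [t t0 [y' Fy']]|_ [[u v] [t t0 Gt] <-]].
  exists (u, t^-1 *: (y' - z.2)) => //; exists t => //.
  rewrite /gph /= scalerA mulfV ?gt_eqF// scale1r.
  by rewrite subrKC.
by exists t => //; exists (z.2 + t *: v).
Qed.

(** Moving along [(0, v)] does not change the first coordinate, so the moving
point stays over the same fiber. *)
Lemma feasible_fiber {R : realFieldType} {X Y : lmodType R} (F : X -> set Y)
    (z : X * Y) :
  feasible (F z.1) z.2 = [set v | feasible (gph F) z (0, v)].
Proof.
by apply/seteqP; split=> v [t t0 Ft]; exists t => //;
  move: Ft; rewrite /gph /= scaler0 addr0.
Qed.

Lemma iri_gph_sub {R : realFieldType} {X Y : lmodType R} (F : X -> set Y)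
    (z : X * Y) :
  iri (gph F) z -> iri (dom F) z.1 /\ iri (F z.1) z.2.
Proof.
move=> /iriE[Gz subK]; split; apply/iriE; split=> //.
- by exists z.2.
- by rewrite feasible_dom; exact: linear_subspace_image.
- by rewrite feasible_fiber; exact: linear_subspace_slice.
Qed.

Lemma iri_gph_convex {R : realFieldType} {X Y : lmodType R} (F : X -> set Y)
    (z : X * Y) :
  convex_mapping F -> iri (dom F) z.1 -> iri (F z.1) z.2 -> iri (gph F) z.
Proof.
move=> cF /iriE[_ subD] /iriE[Fz subF].
apply/iriE; split=> //; apply: linear_subspace_feasible => // -[u v] Kuv.
have : feasible (dom F) z.1 (- u).
  by apply: linear_subspaceN => //; rewrite feasible_dom; exists (u, v).
rewrite feasible_dom => -[[u' w] /[swap] /= -> Kw].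
have : feasible (F z.1) z.2 (- (v + w)).
  apply: linear_subspaceN => //; rewrite feasible_fiber /=.
  by have := feasibleD cF Kuv Kw; congr feasible; apply/pair_eqP;
    rewrite /= subrr !eqxx.
rewrite feasible_fiber => /= K0; have := feasibleD cF K0 Kw.
by congr feasible; apply/pair_eqP; rewrite /= add0r opprD subrK !eqxx.
Qed.

Theorem theorem4p1 (R : realType) (X Y : tvsType R) (F : X -> set Y) :
  iri (gph F) `<=` [set z : X * Y | iri (dom F) z.1 /\ iri (F z.1) z.2]
  /\ (convex_mapping F ->
      iri (gph F) = [set z : X * Y | iri (dom F) z.1 /\ iri (F z.1) z.2]).
Proof.
have sub : iri (gph F) `<=` [set z : X * Y | iri (dom F) z.1 /\ iri (F z.1) z.2].
  by move=> z; exact: iri_gph_sub.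
split=> // cF; apply/seteqP; split=> // z [Dz Fz].
exact: iri_gph_convex.
Qed.
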